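(* Let $(X,p)$ be a partial metric space and let $a$ be a positive real number such that $p(x,x)=a$ for all $x\in X$. Let $r\ge 0$ be a real number. Then for every sequence $\{x_n\}$ in $X$ we have $\operatorname{diam}(st\text{-}LIM^{r}x_n)\le 2r+2a$.
   Context: A partial metric on a nonempty set $X$ is a function $p:X\times X\to[0,\infty)$ such that for all $x,y,z\in X$: (p1) $0\le p(x,x)\le p(x,y)$; (p2) $x=y$ if and only if $p(x,x)=p(x,y)=p(y,y)$; (p3) $p(x,y)=p(y,x)$; (p4) $p(x,y)\le p(x,z)+p(z,y)-p(z,z)$. The pair $(X,p)$ is called a partial metric space. For $B\subset\mathbb N$, the natural density is $d(B)=\lim_{n\to\infty}\frac{|\{k\in B:k\le n\}|}{n}$, if the limit exists. For a real number $r\ge 0$, a sequence $\{x_n\}$ in $X$ is $r$-statistically convergent to $x\in X$ if for every $\varepsilon>0$, $d(\{n\in\mathbb N:|p(x_n,x)-p(x,x)|\ge r+\varepsilon\})=0$. The $r$-st limit set $st\text{-}LIM^{r}x_n$ is the set of all $x\in X$ such that $\{x_n\}$ is $r$-statistically convergent to $x$. For $B\subset X$, $\operatorname{diam}(B)=\sup\{p(x,y):x,y\in B\}$, the supremum being taken in $[0,\infty]$ (so $\operatorname{diam}(\emptyset)=0$). *)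

(* Defs.v *)
From mathcomp Require Import all_boot all_order all_algebra.
From mathcomp Require Import all_classical all_reals all_analysis.
Import Order.TTheory GRing.Theory Num.Theory.
Import numFieldNormedType.Exports.

Set Implicit Arguments.
Unset Strict Implicit.
Unset Printing Implicit Defensive.

Local Open Scope classical_set_scope.
Local Open Scope ring_scope.

(* The codomain [0, oo) is expressed by the first inequality of pmetric_ge0_le,
   which with the second one gives 0 <= p x y for all x, y. *)
Record partial_metric (R : realType) (X : Type) (p : X -> X -> R) : Prop :=
  PartialMetric {
    pmetric_ge0_le : forall x y, 0 <= p x x <= p x y;
    pmetric_eq : forall x y, x = y <-> (p x x = p x y /\ p x y = p y y);
    pmetric_sym : forall x y, p x y = p y x;
    pmetric_triangle : forall x y z, p x y <= p x z + p z y - p z z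
  }.

(* "d(B) exists and equals l". The positive integers are the indices, so 0 is
   never counted; the term n = 0 of the sequence is irrelevant to the limit. *)
Definition has_natural_density (R : realType) (B : set nat) (l : R) : Prop :=
  (fun n : nat => (count (fun k => k \in B) (iota 1 n))%:R / n%:R : R) @ \oo
    --> l.

(* As densities ignore the index 0, x stands for the sequence x 1, x 2, ... *)
Definition r_stat_convergent (R : realType) (X : Type) (p : X -> X -> R)
    (r : R) (x : nat -> X) (l : X) : Prop :=
  forall eps : R, 0 < eps ->
    has_natural_density [set n | `|p (x n) l - p l l| >= r + eps] (0 : R).

Definition st_LIM (R : realType) (X : Type) (p : X -> X -> R)
    (r : R) (x : nat -> X) : set X :=
  [set l | r_stat_convergent p r x l].

(* The supremum is taken in [0, +oo]: adjoining 0 makes diam p set0 = 0,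
   whereas ereal_sup set0 = -oo. *)
Definition diam (R : realType) (X : Type) (p : X -> X -> R) (B : set X)
    : \bar R :=
  ereal_sup ([set (0 : R)%:E] `|` [set (p x y)%:E | x in B & y in B]).

(* Main.v *)
(* Two index sets of density 0 do not cover the positive integers, so some
   term x_n is within r + a/2 of both limits y and z in the sense
   p(x_n, y), p(x_n, z) < a + r + a/2. The triangle inequality through x_n
   gives p(y, z) < 2 (a + r + a/2) - a = 2 r + 2 a. *)
Require Import Defs.
From mathcomp Require Import all_boot all_order all_algebra.
From mathcomp Require Import all_classical all_reals all_analysis.
From mathcomp Require Import lra.
Import Order.TTheory GRing.Theory Num.Theory.
Import numFieldNormedType.Exports.

Local Open Scope classical_set_scope.
Local Open Scope ring_scope.

(** If the two sets covered every index, their counts up to [n] would add up to at least [n], so the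
    two ratios could not both tend to 0. *)
Lemma density0_not_cover (R : realType) (A B : set nat) :
  has_natural_density A (0 : R) -> has_natural_density B (0 : R) ->
  exists n, ~ A n /\ ~ B n.
Proof.
move=> dA dB; apply: contrapT => cover.
have AB n : (n \in A) || (n \in B).
  apply/orP; have [An|nAn] := pselect (A n); first by left; apply/mem_set.
  have [Bn|nBn] := pselect (B n); first by right; apply/mem_set.
  by case: cover; exists n.
have {}dAB := cvgD dA dB.
have [N _ {}dAB] := iffLR (cvgrPdist_lt _ _) (dAB _) 1 ltr01.
(* Evaluating at [N.+1] rather than [N] keeps the denominator positive. *)
have := dAB N.+1 (leqnSn N); rewrite /= addr0 sub0r normrN fctE -mulrDl -natrD.
rewrite ger0_norm ?divr_ge0 ?ler0n // ltr_pdivrMr ?ltr0n // mul1r ltr_nat.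
(* Inclusion-exclusion: the two counts sum to that of the union, which is everything, plus that of
   the intersection. *)
apply/negP; rewrite -leqNgt -count_predUI.
apply: leq_trans (leq_addr _ _).
by rewrite (eq_count (a2 := predT)) ?count_predT ?size_iota // => n; exact: AB.
Qed.

Theorem theorem2p2 (R : realType) (X : Type) (X_nonempty : inhabited X)
    (p : X -> X -> R) (p_pm : partial_metric p)
    (a : R) (a_gt0 : 0 < a) (p_diag : forall x : X, p x x = a)
    (r : R) (r_ge0 : 0 <= r) (x : nat -> X) :
  (diam p (st_LIM p r x) <= (2 * r + 2 * a)%:E)%E.
Proof.
(* The first case is the 0 adjoined in [diam]. *)
apply: ge_ereal_sup => _ [->|[y y_lim [z z_lim <-]]]; rewrite lee_fin; first lra.
have a2_gt0 : 0 < a / 2 by lra.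
have [n [/= /negP]] := density0_not_cover _ _ _ (y_lim _ a2_gt0) (z_lim _ a2_gt0).
rewrite -ltNge p_diag ltr_norml => /andP[_ xy] /negP.
rewrite -ltNge p_diag ltr_norml => /andP[_ xz].
have := pmetric_triangle p_pm y z (x n).
rewrite (pmetric_sym p_pm y (x n)) p_diag; lra.
Qed.
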